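(* Let $N$ be any positive integer and let $\rho^A, \rho^B \in \Omega_N$. If $\rho \in \Gamma^Q(\rho^A,\rho^B)$ is a matrix at which the maximum value of the SWAP fidelity $F_S(\rho^A,\rho^B)$ is achieved, that is, $\operatorname{Tr}(S\rho) = F_S(\rho^A,\rho^B) = \max_{\rho^{AB} \in \Gamma^Q(\rho^A,\rho^B)} \operatorname{Tr}(S\rho^{AB})$, then $\det(\rho) = 0$, where $\rho$ is regarded as an $N^2 \times N^2$ complex matrix.
   Context: For a positive integer $n$, $\Omega_n$ denotes the set of $n \times n$ density matrices, i.e. complex positive semidefinite (Hermitian) $n \times n$ matrices of trace $1$. Identify $\mathbb{C}^{N\times N} \otimes \mathbb{C}^{N\times N}$ with $\mathbb{C}^{N^2\times N^2}$ (matrices acting on $\mathbb{C}^N \otimes \mathbb{C}^N$) via the Kronecker product. The partial traces $\operatorname{Tr}_A, \operatorname{Tr}_B : \mathbb{C}^{N^2\times N^2} \to \mathbb{C}^{N\times N}$ are the linear maps determined by $\operatorname{Tr}_A(X \otimes Y) = \operatorname{Tr}(X)\,Y$ and $\operatorname{Tr}_B(X \otimes Y) = \operatorname{Tr}(Y)\,X$. Equivalently, for an $N^2 \times N^2$ matrix written in $N \times N$ blocks $(X_{ij})_{1 \le i,j \le N}$, one partial trace is $\sum_{i=1}^N X_{ii}$ (this is $\operatorname{Tr}_A$) and the other is the $N\times N$ matrix $(\operatorname{Tr}(X_{ij}))_{i,j}$ (this is $\operatorname{Tr}_B$). For $\rho^A, \rho^B \in \Omega_N$, define $$\Gamma^Q(\rho^A,\rho^B)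 = \{ \rho^{AB} \in \Omega_{N^2} : \operatorname{Tr}_A(\rho^{AB}) = \rho^B,\ \operatorname{Tr}_B(\rho^{AB}) = \rho^A \}.$$ The SWAP operator $S$ is the linear operator on $\mathbb{C}^N \otimes \mathbb{C}^N$ with $S(x \otimes y) = y \otimes x$ for all $x,y \in \mathbb{C}^N$. For any $N$, the SWAP fidelity is the function on $\Omega_N \times \Omega_N$ given by $F_S(\rho^A,\rho^B) = \max_{\rho^{AB} \in \Gamma^Q(\rho^A,\rho^B)} \operatorname{Tr}(S\rho^{AB})$; the feasible set $\Gamma^Q(\rho^A,\rho^B)$ is non-empty, convex and compact, so the maximum exists.
   Formalization: The claim is proved for N at least 2 instead of any positive integer N: for N = 1 the only density matrix is [1], it achieves the maximum, and its determinant is 1, so the statement fails there. *)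

(* Defs.v *)
(* The real numbers are an arbitrary [R : realType], the complex ones [R[i]]. *)
From mathcomp Require Import all_boot all_order all_algebra.
From mathcomp Require Import spectral.
From mathcomp Require Import boolp classical_sets reals.
From mathcomp Require Import complex mxtens ring.

Set Implicit Arguments.
Unset Strict Implicit.
Unset Printing Implicit Defensive.

Import Order.TTheory GRing.Theory Num.Theory.
Local Open Scope classical_set_scope.
Local Open Scope ring_scope.
Local Open Scope complex_scope.

(* The order of [R[i]] is the partial one: [0 <= z] says that [z] is real and
   nonnegative. *)
Definition psdmx (R : realType) (n : nat) (X : 'M[R[i]]_n) : Prop :=
  X \is hermsymmx /\
  forall x : 'cV[R[i]]_n, 0 <= ((map_mx Num.conj x)^T *m X *m x) 0 0.

Definition density (R : realType) (n : nat) : set 'M[R[i]]_n :=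
  [set X | psdmx X /\ \tr X = 1].

(* C^N (x) C^N is C^(N * N) through [mxtens_index (i, j) = i * N + j], the
   indexing used by the Kronecker product [tensmx]. *)
Definition ptraceA (R : realType) (N : nat) (X : 'M[R[i]]_(N * N)) :
    'M[R[i]]_N :=
  \matrix_(j, l) \sum_(i < N) X (mxtens_index (i, j)) (mxtens_index (i, l)).

Definition ptraceB (R : realType) (N : nat) (X : 'M[R[i]]_(N * N)) :
    'M[R[i]]_N :=
  \matrix_(i, k) \sum_(j < N) X (mxtens_index (i, j)) (mxtens_index (k, j)).

Definition coupling (R : realType) (N : nat) (rA rB : 'M[R[i]]_N) :
    set 'M[R[i]]_(N * N) :=
  [set X | [/\ density X, ptraceA X = rB & ptraceB X = rA]].

Definition swapmx (R : realType) (N : nat) : 'M[R[i]]_(N * N) :=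
  \matrix_(r, c) (mxtens_unindex r == ((mxtens_unindex c).2,
                                       (mxtens_unindex c).1))%:R.

(* On [coupling rA rB] the trace is real and at most 1 ([swap_trace_le1]), so
   that [Re] loses nothing and the supremum is the maximum as soon as it is
   attained ([swap_fidelityP]). *)
Definition swap_fidelity (R : realType) (N : nat) (rA rB : 'M[R[i]]_N) : R :=
  sup [set complex.Re (\tr (swapmx R N *m X)) | X in coupling rA rB].

Lemma ptraceA_tens (R : realType) (N : nat) (X Y : 'M[R[i]]_N) :
  ptraceA (tensmx X Y) = \tr X *: Y.
Proof.
apply/matrixP => j l; rewrite !mxE /mxtrace mulr_suml.
by apply: eq_bigr => i _; rewrite tensmxE.
Qed.

Lemma ptraceB_tens (R : realType) (N : nat) (X Y : 'M[R[i]]_N) :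
  ptraceB (tensmx X Y) = \tr Y *: X.
Proof.
apply/matrixP => j l; rewrite !mxE /mxtrace mulr_suml.
by apply: eq_bigr => i _; rewrite tensmxE mulrC.
Qed.

Lemma sum_mxtens (V : nmodType) (m n : nat) (F : 'I_(m * n) -> V) :
  \sum_k F k = \sum_i \sum_j F (mxtens_index (i, j)).
Proof.
rewrite pair_big /= (reindex (@mxtens_index m n)) /=.
  by apply: eq_bigr => -[].
by exists (@mxtens_unindex m n) => i _; rewrite (mxtens_indexK, mxtens_unindexK).
Qed.

Lemma swapmxM (R : realType) (N p : nat) (X : 'M[R[i]]_(N * N, p)) i j k :
  (swapmx R N *m X) (mxtens_index (i, j)) k = X (mxtens_index (j, i)) k.
Proof.
rewrite mxE (bigD1 (mxtens_index (j, i))) //= mxE !mxtens_indexK eqxx mul1r.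
rewrite big1 ?addr0 // => c; case: (mxtens_indexP c) => a b nab.
rewrite mxE !mxtens_indexK xpair_eqE /=.
case: (i =P b) => [eib|]; last by rewrite mul0r.
case: (j =P a) => [eja|]; last by rewrite mul0r.
by move: nab; rewrite eib eja eqxx.
Qed.

Lemma swapmx_tens (R : realType) (N : nat) (x y : 'cV[R[i]]_N) :
  swapmx R N *m tensmx x y = tensmx y x.
Proof.
apply/matrixP => r c; case: (mxtens_indexP r) => i j.
case: (mxtens_indexP c) => k l.
by rewrite swapmxM !tensmxE [k]ord1 [l]ord1 mulrC.
Qed.

Lemma swap_traceE (R : realType) (N : nat) (X : 'M[R[i]]_(N * N)) :
  \tr (swapmx R N *m X) =
  \sum_i \sum_j X (mxtens_index (j, i)) (mxtens_index (i, j)).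
Proof.
rewrite /mxtrace sum_mxtens; apply: eq_bigr => i _; apply: eq_bigr => j _.
exact: swapmxM.
Qed.

Lemma swap_trace_le1 (R : realType) (N : nat) (X : 'M[R[i]]_(N * N)) :
  density X -> \tr (swapmx R N *m X) <= 1.
Proof.
move=> [[_ pX] trX].
pose D i j : R[i] := X (mxtens_index (i, j)) (mxtens_index (i, j)).
pose T i j : R[i] := X (mxtens_index (j, i)) (mxtens_index (i, j)).
have trD : \sum_i \sum_j D i j = 1 by rewrite -trX /mxtrace sum_mxtens.
have trT : \sum_i \sum_j T i j = \tr (swapmx R N *m X) by rewrite swap_traceE.
have D2 : \sum_i \sum_j (D i j + D j i - (T i j + T j i)) =
          (1 - \tr (swapmx R N *m X)) *+ 2.
  under eq_bigr do rewrite sumrB !big_split.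
  rewrite sumrB !big_split /= [X in _ + X - _]exchange_big.
  by rewrite [X in _ - (_ + X)]exchange_big /= trD trT mulrnBl !mulr2n.
suff: 0 <= (1 - \tr (swapmx R N *m X)) *+ 2 by rewrite pmulrn_lge0 // subr_ge0.
rewrite -D2; apply: sumr_ge0 => i _; apply: sumr_ge0 => j _.
pose u : 'cV[R[i]]_(N * N) :=
  delta_mx (mxtens_index (i, j)) 0 - delta_mx (mxtens_index (j, i)) 0.
have cu : (map_mx Num.conj u)^T =
    delta_mx 0 (mxtens_index (i, j)) - delta_mx 0 (mxtens_index (j, i)).
  by apply/matrixP => a b; rewrite !mxE rmorphB !rmorph_nat /= ![(b == _) && _]andbC.
have dE a b : (delta_mx 0 a *m X *m (delta_mx b 0 : 'cV_(N * N))) (0 : 'I_1) 0 = X a b.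
  by rewrite -rowE -colE !mxE.
have subE (A B : 'M[R[i]]_1) : (A - B) 0 0 = A 0 0 - B 0 0 by rewrite !mxE.
have := pX u; rewrite cu !(mulmxBl, mulmxBr) !subE !dE /D /T.
by congr (is_true (0 <= _)); ring.
Qed.

Lemma swap_trace_real (R : realType) (N : nat) (X : 'M[R[i]]_(N * N)) :
  density X ->
  \tr (swapmx R N *m X) = (complex.Re (\tr (swapmx R N *m X)))%:C.
Proof.
by move=> /swap_trace_le1; case: (\tr _) => a b; rewrite lecE /= => /andP[/eqP <-].
Qed.

Lemma swap_fidelityP (R : realType) (N : nat) (rA rB : 'M[R[i]]_N)
    (X : 'M[R[i]]_(N * N)) : coupling rA rB X ->
  (\tr (swapmx R N *m X) = (swap_fidelity rA rB)%:C <->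
   forall Y, coupling rA rB Y ->
     \tr (swapmx R N *m Y) <= \tr (swapmx R N *m X)).
Proof.
move=> cX; have [dX _ _] := cX.
set F := [set complex.Re (\tr (swapmx R N *m Y)) | Y in coupling rA rB].
have FX : F (complex.Re (\tr (swapmx R N *m X))) by exists X.
have supF : has_sup F.
  split; first by exists (complex.Re (\tr (swapmx R N *m X))).
  exists 1 => _ [Y [dY _ _] <-].
  by have := swap_trace_le1 dY; rewrite (swap_trace_real dY) lecR.
split=> [eX Y cY|maxX].
  have [dY _ _] := cY; rewrite eX (swap_trace_real dY) lecR.
  by apply: ub_le_sup; [exact: supF.2|exists Y].
rewrite (swap_trace_real dX); congr (_%:C); apply/eqP.
rewrite eq_le ub_le_sup //=; last exact: supF.2.
apply: ge_sup; first exact: supF.1.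
move=> _ [Y cY <-]; have [dY _ _] := cY.
by have := maxX _ cY; rewrite (swap_trace_real dY) (swap_trace_real dX) lecR.
Qed.

(* For N = 1 the only density matrix is 1, so that a determinant can vanish on
   maximizers only for N > 1. *)
Lemma det_density1 (R : realType) (X : 'M[R[i]]_(1 * 1)) :
  density X -> \det X = 1.
Proof. by move=> [_ <-]; rewrite det_mx11 /mxtrace big_ord1. Qed.

(* Main.v *)
Require Import Defs.
From mathcomp Require Import all_boot all_order all_algebra.
From mathcomp Require Import spectral.
From mathcomp Require Import boolp classical_sets reals.
From mathcomp Require Import complex mxtens ring.

(** A maximizer of a linear functional cannot be an interior point of the
    feasible set in a direction along which the functional increases.  If
    [\det rho != 0] then [rho] is positive definite, so that it stays positive
    when it is moved a little in any Hermitian direction.  For two distinct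
    basis vectors [a], [b] (here [1 < N] enters) the direction
    [H = |ab><ba| + |ba><ab|] ([flipmx a b]) has both partial traces equal to [0], because
    [ab] and [ba] differ in both factors; hence [rho + e *: H] is again a
    coupling of the same marginals.  But SWAP exchanges [ab] and [ba], so that
    [\tr (S *m H) = 2], and the value at [rho] is exceeded by [2 * e]
    ([swap_trace_flip]).

    That a positive definite matrix may be moved needs neither eigenvalues nor
    compactness.  By polarization, [2 *: H] is the difference of the rank one
    matrices of [ab + ba] and of [ab - ba], and only the second one, [w w^*],
    can harm positivity.  Writing [w = rho *m y], the Cauchy-Schwarz inequality
    for the form of [rho] bounds [w w^*] by [(y^* rho y) *: rho], so that a
    small multiple of it may be subtracted ([psdmx_sub_dyad]). *)

Set Implicit Arguments.
Unset Strict Implicit.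
Unset Printing Implicit Defensive.

Import Order.TTheory GRing.Theory Num.Theory.
Local Open Scope classical_set_scope.
Local Open Scope ring_scope.
Local Open Scope complex_scope.

Definition adjmx (R : realType) (m n : nat) (X : 'M[R[i]]_(m, n)) :
    'M[R[i]]_(n, m) :=
  (map_mx Num.conj X)^T.

Definition dyad (R : realType) (n : nat) (w : 'cV[R[i]]_n) : 'M[R[i]]_n :=
  w *m adjmx w.

(** * Adjoints and positive semidefinite matrices *)

Lemma adjmxK (R : realType) (m n : nat) (X : 'M[R[i]]_(m, n)) :
  adjmx (adjmx X) = X.
Proof. by apply/matrixP => i j; rewrite !mxE conjCK. Qed.

Lemma adjmxM (R : realType) (m n p : nat) (X : 'M[R[i]]_(m, n))
    (Y : 'M[R[i]]_(n, p)) :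
  adjmx (X *m Y) = adjmx Y *m adjmx X.
Proof. by rewrite /adjmx map_mxM trmx_mul. Qed.

Lemma adjmxD (R : realType) (m n : nat) (X Y : 'M[R[i]]_(m, n)) :
  adjmx (X + Y) = adjmx X + adjmx Y.
Proof. by rewrite /adjmx map_mxD linearD. Qed.

Lemma adjmxB (R : realType) (m n : nat) (X Y : 'M[R[i]]_(m, n)) :
  adjmx (X - Y) = adjmx X - adjmx Y.
Proof. by rewrite /adjmx map_mxB linearB. Qed.

Lemma adjmxZ (R : realType) (m n : nat) (c : R[i]) (X : 'M[R[i]]_(m, n)) :
  adjmx (c *: X) = Num.conj c *: adjmx X.
Proof. by rewrite /adjmx map_mxZ linearZ. Qed.

Lemma adjmx_delta (R : realType) (m n : nat) (i : 'I_m) (j : 'I_n) :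
  adjmx (delta_mx i j : 'M[R[i]]_(m, n)) = delta_mx j i.
Proof. by rewrite /adjmx map_delta_mx trmx_delta. Qed.

Lemma hermsymmx_adjE (R : realType) (n : nat) (X : 'M[R[i]]_n) :
  (X \is hermsymmx) = (X == adjmx X).
Proof. by rewrite is_hermitianmxE expr0 scale1r /adjmx map_trmx. Qed.

Lemma adjmx_dyad (R : realType) (n : nat) (w : 'cV[R[i]]_n) :
  adjmx (dyad w) = dyad w.
Proof. by rewrite /dyad adjmxM adjmxK. Qed.

Lemma psdmxD (R : realType) (n : nat) (X Y : 'M[R[i]]_n) :
  psdmx X -> psdmx Y -> psdmx (X + Y).
Proof.
move=> [hX pX] [hY pY]; split=> [|x].
  move: hX hY; rewrite !hermsymmx_adjE => /eqP hX /eqP hY.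
  by rewrite adjmxD -hX -hY.
by rewrite mulmxDr mulmxDl mxE addr_ge0.
Qed.

Lemma psdmxZ (R : realType) (n : nat) (e : R[i]) (X : 'M[R[i]]_n) :
  0 <= e -> psdmx X -> psdmx (e *: X).
Proof.
move=> e0 [hX pX]; split=> [|x].
  move: hX; rewrite !hermsymmx_adjE => /eqP hX.
  by rewrite adjmxZ -hX conj_Creal // ger0_real.
by rewrite -scalemxAr -scalemxAl mxE mulr_ge0.
Qed.

Lemma mulmx_dyad00 (R : realType) (n : nat) (w x : 'cV[R[i]]_n) :
  (adjmx x *m dyad w *m x) 0 0 =
  (adjmx w *m x) 0 0 * Num.conj ((adjmx w *m x) 0 0).
Proof.
rewrite /dyad mulmxA -mulmxA mxE big_ord1 mulrC; congr (_ * _).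
by rewrite -[adjmx x *m w]adjmxK adjmxM adjmxK 2!mxE.
Qed.

Lemma psdmx_dyad (R : realType) (n : nat) (w : 'cV[R[i]]_n) : psdmx (dyad w).
Proof.
split=> [|x]; first by rewrite hermsymmx_adjE adjmx_dyad.
by rewrite -/(adjmx x) mulmx_dyad00 mul_conjC_ge0.
Qed.

(** Cauchy-Schwarz for the form of [X] makes [dyad (X *m y)] at most a multiple
    of [X], whatever [y] is.  The proof expands the form
    [<y, x> = y^* X x] at the vector [x - e <y, x> y]. *)
Lemma psdmx_sub_dyad (R : realType) (n : nat) (X : 'M[R[i]]_n)
    (y : 'cV[R[i]]_n) :
  psdmx X -> exists2 e : R[i], 0 < e & psdmx (X - e *: dyad (X *m y)).
Proof.
move=> [hX pX]; have /eqP adjX : X == adjmx X by rewrite -hermsymmx_adjE.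
pose c := (adjmx y *m X *m y) 0 0; have c0 : 0 <= c by exact: pX.
have c1 : 0 < 1 + c by rewrite ltr_pwDl.
(* Any positive [e] with [e * c <= 1] would do; this one has [1 - e * c = e]. *)
pose e := (1 + c)^-1; have e0 : 0 < e by rewrite invr_gt0.
have ce : 1 - e * c = e.
  by apply: (mulfI (lt0r_neq0 c1)); rewrite mulrBr mulrA mulfV ?lt0r_neq0 //; ring.
have eC : Num.conj e = e by rewrite conj_Creal // ger0_real // ltW.
exists e; first exact: e0.
split=> [|x].
  by rewrite hermsymmx_adjE adjmxB adjmxZ eC adjmx_dyad -adjX.
rewrite -/(adjmx x).
pose f (u v : 'cV[R[i]]_n) := (adjmx u *m X *m v) 0 0.
have fBl u v z : f (u - v) z = f u z - f v z.
  by rewrite /f adjmxB !mulmxBl !mxE.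
have fBr u v z : f z (u - v) = f z u - f z v by rewrite /f mulmxBr !mxE.
have fZl a u v : f (a *: u) v = Num.conj a * f u v.
  by rewrite /f adjmxZ -mulmxA -scalemxAl mulmxA mxE.
have fZr a u v : f u (a *: v) = a * f u v by rewrite /f -scalemxAr mxE.
pose s := f y x.
have sE : (adjmx (X *m y) *m x) 0 0 = s by rewrite adjmxM -adjX.
have sC : f x y = Num.conj s.
  by rewrite /f -mulmxA -[X *m y]adjmxK -[_ *m adjmx _]adjmxM 2!mxE sE.
have : 0 <= f (x - (e * s) *: y) (x - (e * s) *: y) by exact: pX.
rewrite fBl !fBr !fZl !fZr -[f y y]/c -/s sC rmorphM /= eC.
have -> : (adjmx x *m (X - e *: dyad (X *m y)) *m x) 0 0 =
    f x x - e * (s * Num.conj s).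
  rewrite mulmxBr mulmxBl -scalemxAr -scalemxAl -sE -mulmx_dyad00 /f.
  move: (_ *m x) (_ *m x) => A B.
  by rewrite !mxE.
set s' := Num.conj s => posq.
have ess0 : 0 <= e * e * (s * s').
  by rewrite mulr_ge0 ?mul_conjC_ge0 // mulr_ge0 // ltW.
apply: le_trans (addr_ge0 posq ess0) _; rewrite le_eqVlt; apply/orP; left.
by apply/eqP; rewrite -[X in X * e * (s * s')]ce; ring.
Qed.

(** Polarization: up to the factor 2, the Hermitian matrix that exchanges two
    basis vectors is the difference of the dyads of their sum and of their
    difference.  Invertibility of [X] puts the latter vector in the range of
    [X], so that a multiple of its dyad may be subtracted. *)
Lemma psdmx_add_delta (R : realType) (n : nat) (X : 'M[R[i]]_n) (p q : 'I_n) :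
  psdmx X -> \det X != 0 ->
  exists2 e : R[i], 0 < e & psdmx (X + e *: (delta_mx p q + delta_mx q p)).
Proof.
move=> pX dX.
pose v : 'cV[R[i]]_n := delta_mx p 0 + delta_mx q 0.
pose w : 'cV[R[i]]_n := delta_mx p 0 - delta_mx q 0.
have [e e0] := psdmx_sub_dyad (invmx X *m w) pX.
rewrite mulKVmx ?unitmxE ?unitfE // => pXw.
exists (e *+ 2); first by rewrite pmulrn_rgt0.
have vw : dyad v - dyad w = (delta_mx p q + delta_mx q p) *+ 2.
  rewrite /dyad adjmxD adjmxB !adjmx_delta !(mulmxBl, mulmxBr, mulmxDl, mulmxDr).
  rewrite !mul_delta_mx; move: (delta_mx _ _) (delta_mx p q) => A B.
  by apply/matrixP => i j; rewrite !mxE; ring.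
rewrite -scalerMnl scalerMnr -vw scalerBr addrCA addrC.
by apply: psdmxD pXw _; apply: psdmxZ (ltW e0) _; exact: psdmx_dyad.
Qed.

(** * The direction of increase *)

Definition flipmx (R : realType) (N : nat) (i j : 'I_N) : 'M[R[i]]_(N * N) :=
  delta_mx (mxtens_index (i, j)) (mxtens_index (j, i)) +
  delta_mx (mxtens_index (j, i)) (mxtens_index (i, j)).

(** In this form the partial traces of [flipmx i j] have as coefficients the
    traces of [delta_mx i j] and [delta_mx j i], which vanish when [i != j]. *)
Lemma flipmx_tens (R : realType) (N : nat) (i j : 'I_N) :
  flipmx R i j = tensmx (delta_mx i j) (delta_mx j i) +
                 tensmx (delta_mx j i) (delta_mx i j).
Proof.
apply/matrixP => r c; case: (mxtens_indexP r) => a b.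
case: (mxtens_indexP c) => a' b'; rewrite [RHS]mxE !tensmxE !mxE.
rewrite !(can_eq (@mxtens_indexK N N)) !xpair_eqE -!natrM !mulnb.
by congr (_%:R + _%:R); rewrite !andbA; congr (_ && _); rewrite -!andbA;
   congr (_ && _); rewrite andbC.
Qed.

Lemma mxtrace_delta_neq (R : realType) (N : nat) (i j : 'I_N) :
  i != j -> \tr (delta_mx i j : 'M[R[i]]_N) = 0.
Proof.
move=> nij; rewrite /mxtrace big1 // => k _; rewrite mxE.
by case: eqP => [->|//]; rewrite (negbTE nij).
Qed.

Lemma ptraceAD (R : realType) (N : nat) (X Y : 'M[R[i]]_(N * N)) :
  ptraceA (X + Y) = ptraceA X + ptraceA Y.
Proof.
apply/matrixP => i j; rewrite !mxE -big_split; apply: eq_bigr => k _.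
by rewrite mxE.
Qed.

Lemma ptraceAZ (R : realType) (N : nat) (c : R[i]) (X : 'M[R[i]]_(N * N)) :
  ptraceA (c *: X) = c *: ptraceA X.
Proof.
apply/matrixP => i j; rewrite !mxE mulr_sumr; apply: eq_bigr => k _.
by rewrite mxE.
Qed.

Lemma ptraceBD (R : realType) (N : nat) (X Y : 'M[R[i]]_(N * N)) :
  ptraceB (X + Y) = ptraceB X + ptraceB Y.
Proof.
apply/matrixP => i j; rewrite !mxE -big_split; apply: eq_bigr => k _.
by rewrite mxE.
Qed.

Lemma ptraceBZ (R : realType) (N : nat) (c : R[i]) (X : 'M[R[i]]_(N * N)) :
  ptraceB (c *: X) = c *: ptraceB X.
Proof.
apply/matrixP => i j; rewrite !mxE mulr_sumr; apply: eq_bigr => k _.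
by rewrite mxE.
Qed.

Lemma mxtrace_ptraceA (R : realType) (N : nat) (X : 'M[R[i]]_(N * N)) :
  \tr (ptraceA X) = \tr X.
Proof.
rewrite [RHS]/mxtrace sum_mxtens exchange_big.
by apply: eq_bigr => j _; rewrite mxE.
Qed.

Lemma ptraceA_flip (R : realType) (N : nat) (i j : 'I_N) :
  i != j -> ptraceA (flipmx R i j) = 0.
Proof.
move=> nij; have nji : j != i by rewrite eq_sym.
rewrite flipmx_tens ptraceAD !ptraceA_tens.
by rewrite (mxtrace_delta_neq _ nij) (mxtrace_delta_neq _ nji) !scale0r addr0.
Qed.

Lemma ptraceB_flip (R : realType) (N : nat) (i j : 'I_N) :
  i != j -> ptraceB (flipmx R i j) = 0.
Proof.
move=> nij; have nji : j != i by rewrite eq_sym.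
rewrite flipmx_tens ptraceBD !ptraceB_tens.
by rewrite (mxtrace_delta_neq _ nij) (mxtrace_delta_neq _ nji) !scale0r addr0.
Qed.

Lemma swapmx_delta (R : realType) (N p : nat) (i j : 'I_N) (k : 'I_p) :
  swapmx R N *m delta_mx (mxtens_index (i, j)) k =
  delta_mx (mxtens_index (j, i)) k.
Proof.
apply/matrixP => r c; case: (mxtens_indexP r) => a b.
rewrite swapmxM !mxE !(can_eq (@mxtens_indexK N N)) !xpair_eqE.
by rewrite [(b == i) && _]andbC.
Qed.

Lemma swap_trace_flip (R : realType) (N : nat) (i j : 'I_N) :
  \tr (swapmx R N *m flipmx R i j) = 2.
Proof.
have trd n (k : 'I_n) : \tr (delta_mx k k : 'M[R[i]]_n) = 1.
  rewrite /mxtrace (bigD1 k) //= mxE !eqxx big1 ?addr0 // => l nlk.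
  by rewrite mxE (negbTE nlk).
by rewrite /flipmx mulmxDr !swapmx_delta mxtraceD !trd.
Qed.

Theorem theorem1 (R : realType) (N : nat) (hN : (1 < N)%N)
    (rA rB : 'M[R[i]]_N) (hA : density rA) (hB : density rB)
    (rho : 'M[R[i]]_(N * N)) (hrho : coupling rA rB rho)
    (hmax : \tr (swapmx R N *m rho) = (swap_fidelity rA rB)%:C) :
  \det rho = 0.
Proof.
apply/eqP/negPn/negP => det_rho.
have [[psd_rho tr_rho] ptA ptB] := hrho.
pose a : 'I_N := Ordinal (ltnW hN); pose b : 'I_N := Ordinal hN.
have nab : a != b by [].
have [e e0 psd_X] :=
  psdmx_add_delta (mxtens_index (a, b)) (mxtens_index (b, a)) psd_rho det_rho.
rewrite -/(flipmx R a b) in psd_X.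
have ptA_X : ptraceA (rho + e *: flipmx R a b) = rB.
  by rewrite ptraceAD ptraceAZ ptraceA_flip // scaler0 addr0.
have cX : coupling rA rB (rho + e *: flipmx R a b).
  split; last by rewrite ptraceBD ptraceBZ ptraceB_flip // scaler0 addr0.
    by split=> //; rewrite -mxtrace_ptraceA ptA_X -ptA mxtrace_ptraceA.
  exact: ptA_X.
have := (swap_fidelityP hrho).1 hmax _ cX.
rewrite mulmxDr -scalemxAr mxtraceD mxtraceZ swap_trace_flip gerDl.
by rewrite pmulr_rle0 // lern0.
Qed.
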